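(* Let $n\ge 8$, let $\Lambda\subset\mathbb{R}^n$ be an $n$-dimensional unimodular lattice, let $\ell=\lfloor n/8\rfloor$, and let $m_0,\dots,m_\ell\in\mathbb{Q}$ (with $\sum_{r=0}^{\ell}m_r=1$) be the coefficients such that $\Delta_\Lambda(\tau)=\sum_{r=0}^{\ell}m_r\,[h(t(\tau))]^r$ for all $\tau>0$. Put $f_\Lambda(t)=\sum_{r=0}^{\ell}m_r\,h(t)^r$ for $t\in[0,1]$. If for any $j\in[1:\ell-1]$ the coefficients $m_0,\dots,m_\ell$ satisfy $$\min\left\{\mu_j=\sum_{r\in[j:\ell]}\frac{r!}{(r-j)!}\,m_r\Bigl(\frac34\Bigr)^{r-j},\ \nu_j=\sum_{r\in[j:\ell]}\frac{r!}{(r-j)!}\,m_r\right\}>0,$$ then $f_\Lambda$ is U-shaped on $[0,1]$ around $1/\sqrt2$.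
   Context: For integers $a\le b$, $[a:b]=\{a,a+1,\dots,b\}$. A (full rank) lattice $\Lambda\subset\mathbb{R}^n$ is unimodular if it is integral (inner products of any two lattice vectors are integers) and equal to its dual lattice $\Lambda^\star$; it then has volume $1$. For $\tau>0$, the theta series is $\Theta_\Lambda(i\tau)=\sum_{\lambda\in\Lambda}e^{-\pi\tau\|\lambda\|^2}$. The Jacobi theta functions are $\vartheta_3(i\tau)=\sum_{v\in\mathbb{Z}}e^{-\pi\tau v^2}$ and $\vartheta_4(i\tau)=\sum_{v\in\mathbb{Z}}(-1)^v e^{-\pi\tau v^2}$; note $\Theta_{\mathbb{Z}^n}(i\tau)=\vartheta_3^n(i\tau)$. The theta series ratio of a volume-one lattice is $\Delta_\Lambda(\tau)=\Theta_\Lambda(i\tau)/\Theta_{\mathbb{Z}^n}(i\tau)$. Let $h(t)=t^4-t^2+1$ and $t(\tau)=\vartheta_4^2(i\tau)/\vartheta_3^2(i\tau)\in[0,1]$ for $\tau>0$. For every $n$-dimensional unimodular lattice $\Lambda$ there exist rational numbers $m_0,\dots,m_\ell$, $\ell=\lfloor n/8\rfloor$, with $\sum_{r=0}^\ell m_r=1$ and $\Delta_\Lambda(\tau)=\sum_{r=0}^\ell m_r[h(t(\tau))]^r$ for all $\tau>0$. A function $f$ is U-shaped on an interval $[a,b]\subseteq\mathbb{R}$ around a point $t_0\in[a,b]$ if its derivative satisfies $f'(t)<0$ for $a\le t<t_0$, $f'(t_0)=0$, and $f'(t)>0$ for $t_0<t\le b$.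
   Formalization: U-shape is proved on [a,1] for every 0<a≤1/√2 instead of on [0,1], since f'(0)=0 always; and for 8≤n<16 (ℓ=1, condition vacuous) Λ is assumed not isometric to Z^n, where f would be constant 1. *)

(* Defs.v *)
(* MathComp-Analysis; the reals are an arbitrary [R : realType]. *)
From HB Require Import structures.
From mathcomp Require Import all_boot all_order all_algebra.
From mathcomp Require Import all_classical all_reals all_analysis.
Set Implicit Arguments.
Unset Strict Implicit.
Unset Printing Implicit Defensive.
Import Order.TTheory GRing.Theory Num.Theory.
Import numFieldNormedType.Exports.
Local Open Scope classical_set_scope.
Local Open Scope ring_scope.

Section Lattices.
Context {R : realType} {n : nat}.
Implicit Types (x y : 'rV[R]_n) (L : set 'rV[R]_n).

(* The library norm on row vectors is the sup norm, so the Euclidean structure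
   is given by [dotv]; in particular the squared length of x is [dotv x x]. *)
Definition dotv x y : R := \sum_(i < n) x ord0 i * y ord0 i.

(* Integer combinations of the rows of B. *)
Definition lattice_of (B : 'M[R]_n) : set 'rV[R]_n :=
  [set x | exists u : 'rV[int]_n, x = map_mx intr u *m B].

Definition full_rank_lattice L : Prop :=
  exists2 B : 'M[R]_n, B \in unitmx & L = lattice_of B.

Definition integral_lattice L : Prop :=
  forall x y, L x -> L y -> dotv x y \is a Num.int.

Definition dual_lattice L : set 'rV[R]_n :=
  [set x | forall y, L y -> dotv x y \is a Num.int].

Definition unimodular L : Prop :=
  [/\ full_rank_lattice L, integral_lattice L & L = dual_lattice L].

Definition isometric_to_Zn L : Prop :=
  exists2 Q : 'M[R]_n, Q *m Q^T = 1%:M & L = lattice_of Q.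

End Lattices.

(* Sum of an absolutely summable real family indexed by D, namely the sum of
   its positive part minus the sum of its negative part. *)
Definition set_sum {R : realType} {T : choiceType} (D : set T) (f : T -> R) : R :=
  fine (\esum_(x in D) ((EFin \o f)^\+ x) - \esum_(x in D) ((EFin \o f)^\- x))%E.

Section Theta.
Context {R : realType}.
Implicit Type tau : R.

(* Every theta function is taken at the point i * tau, with tau > 0. *)
Definition theta_series {n : nat} (L : set 'rV[R]_n) tau : R :=
  set_sum L (fun x => expR (- (pi * tau * dotv x x))).

Definition jacobi3 tau : R :=
  set_sum [set: int] (fun v => expR (- (pi * tau * v%:~R ^+ 2))).

Definition jacobi4 tau : R :=
  set_sum [set: int]
    (fun v => (-1) ^+ `|v|%N * expR (- (pi * tau * v%:~R ^+ 2))).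

(* The lattice Z^n is generated by the identity matrix. *)
Definition theta_ratio {n : nat} (L : set 'rV[R]_n) tau : R :=
  theta_series L tau / theta_series (lattice_of (1%:M : 'M[R]_n)) tau.

Definition t_of tau : R := jacobi4 tau ^+ 2 / jacobi3 tau ^+ 2.

Definition hpoly (t : R) : R := t ^+ 4 - t ^+ 2 + 1.

(* Only the values m 0, ..., m l of m matter. *)
Definition f_of (l : nat) (m : nat -> rat) (t : R) : R :=
  \sum_(0 <= r < l.+1) ratr (m r) * hpoly t ^+ r.

(* Two-sided derivatives are used at a and b as well. Since
   derive1 hpoly 0 = 0, every [f_of l m] has a vanishing derivative at 0, so none of
   them satisfies this condition on an interval starting at a = 0 < t0. *)
Definition u_shaped (f : R -> R) (a b t0 : R) : Prop :=
  [/\ a <= t0 <= b,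
      forall t, a <= t <= b -> derivable f t 1,
      forall t, a <= t < t0 -> derive1 f t < 0,
      derive1 f t0 = 0 &
      forall t, t0 < t <= b -> 0 < derive1 f t].

End Theta.

Definition mu (l : nat) (m : nat -> rat) (j : nat) : rat :=
  \sum_(j <= r < l.+1) (r`!%:R / (r - j)`!%:R) * m r * (3%:R / 4%:R) ^+ (r - j).

Definition nu (l : nat) (m : nat -> rat) (j : nat) : rat :=
  \sum_(j <= r < l.+1) (r`!%:R / (r - j)`!%:R) * m r.

(* Main.v *)
Require Import Defs.
From HB Require Import structures.
From mathcomp Require Import all_boot all_order all_algebra.
From mathcomp Require Import all_classical all_reals all_analysis.
From mathcomp Require Import ring lra zify.
Import Order.TTheory GRing.Theory Num.Theory.
Import numFieldNormedType.Exports.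
Local Open Scope classical_set_scope.
Local Open Scope ring_scope.

(** Write G(x) = sum_r m_r x^r, so that f = G o h with h(t) = t^4 - t^2 + 1 and
    f'(t) = G'(h(t)) * 2t(2t^2 - 1).  The last factor is negative on
    (0, 1/sqrt 2), zero at 1/sqrt 2 and positive beyond, and h maps [0, 1] into
    [3/4, 1]; hence f is U-shaped as soon as G' > 0 on [3/4, 1]
    ([u_shaped_of_deriv_gt0]).

    The numbers mu_j and nu_j are the derivatives G^(j)(3/4) and G^(j)(1)
    ([horner_weight_derivn]).  When l >= 2, G^(l-1) is affine and positive at
    both ends of [3/4, 1], hence positive on it; going down, each G^(j) with
    1 <= j < l - 1 is positive at 3/4 and has a positive derivative, hence is
    positive on the interval ([horner_gt0_of_derivs]).

    When l = 1 there is no condition on mu and nu, and G' is the constant m_1,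
    whose sign has to come from the lattice.  Since h <= 1, m_1 <= 0 would make
    the theta ratio 1 - m_1 (1 - h(t)) at least 1 for every tau, so it is enough
    to find one tau where the ratio is below 1, when L is not isometric to Z^n
    ([theta_ratio_lt1]).  In an integral lattice two vectors of norm 1 are equal,
    opposite or orthogonal, so a maximal orthonormal family of k vectors of L
    accounts, up to sign, for all vectors of norm 1.  If k = n, this family
    spans a copy of Z^n inside L, and L, being integral, is contained in the
    dual of that copy, which is the copy itself; so k < n
    ([few_unit_vectors]).  With q = exp(-pi tau) the theta series of L is then
    at most 1 + 2k q + O(q^2), which falls below 1 + 2n q, a lower bound of the
    theta series of Z^n, as tau grows. *)

(** * Positivity of a polynomial from its derivatives at the ends *)
(** The top derivative p^(k) is affine, so positivity at both ends suffices for
    it; for each lower derivative, positivity at a is propagated to the right by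
    the positivity of the next one. *)
Lemma horner_gt0_of_derivs {R : realType} (a b : R) (k : nat) (p : {poly R}) :
  (size p <= k.+2)%N ->
  (forall j, (j <= k)%N -> 0 < (p^`(j)).[a]) -> 0 < (p^`(k)).[b] ->
  forall x, a <= x <= b -> 0 < p.[x].
Proof.
elim: k p => [|k IH] p sp pa pb x /andP[ax xb].
  have pE y : p.[y] = p`_0 + p`_1 * y.
    rewrite (horner_coef_wide _ sp) !big_ord_recl big_ord0 /=.
    by rewrite expr0 expr1 mulr1 addr0.
  have := pa 0 (leqnn 0); move: pb; rewrite !derivn0 !pE => pb pa0.
  have [p1_ge0|p1_lt0] := leP 0 (p`_1).
    by apply: lt_le_trans pa0 _; rewrite lerD2l ler_wpM2l.
  by apply: lt_le_trans pb _; rewrite lerD2l ler_wnM2l// ltW.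
have dp_gt0 y : a <= y <= b -> 0 < (p^`()).[y].
  apply: IH => [|j jk|].
  - have [->|p0] := eqVneq p 0; first by rewrite deriv0 size_poly0.
    by rewrite -ltnS; apply: leq_trans sp; exact: lt_size_deriv.
  - by have := pa j.+1 jk; rewrite /derivn iterSr.
  - by move: pb; rewrite /derivn iterSr.
have [c /itvP cax E] := @MVT_segment R (horner p) (horner p^`()) a x ax
  (fun y _ => is_derive_poly p y)
  (continuous_subspaceT (@continuous_horner _ p)).
have : p.[x] = p.[a] + (p^`()).[c] * (x - a) by rewrite -E addrC subrK.
move=> ->; apply: ltr_wpDr; last exact: pa 0%N _.
apply: mulr_ge0; last by rewrite subr_ge0.
by rewrite ltW// dp_gt0// cax/= (le_trans _ xb)// cax.
Qed.

(** * The weight polynomial and the shape of its composite with h *)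

Definition weight_poly (R : realType) (l : nat) (m : nat -> rat) : {poly R} :=
  \poly_(r < l.+1) ratr (m r).

Lemma ffact_quot (F : numFieldType) r j : (j <= r)%N ->
  (r ^_ j)%:R = r`!%:R / (r - j)`!%:R :> F.
Proof.
by move=> jr; rewrite -(ffact_fact jr) natrM mulfK// pnatr_eq0 -lt0n fact_gt0.
Qed.

(** At x = 3/4 and x = 1 the rational number on the right is [mu l m j] and
    [nu l m j]. *)
Lemma horner_weight_derivn {R : realType} l m j (x : rat) :
  ((weight_poly R l m)^`(j)).[ratr x] =
  ratr (\sum_(j <= r < l.+1) (r`!%:R / (r - j)`!%:R) * m r * x ^+ (r - j)).
Proof.
rewrite /weight_poly poly_def linear_sum horner_sum.
under eq_bigr do rewrite /= derivnZ derivnXn hornerZ hornerMn hornerXn.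
rewrite -(big_mkord xpredT
  (fun r => ratr (m r) * (ratr x ^+ (r - j) *+ r ^_ j) : R)).
rewrite rmorph_sum (big_nat_widenl j 0)// [in RHS]big_mkcond/=.
apply: eq_bigr => r _; case: leqP => [jr|rj]; last first.
  by rewrite ffact_small ?mulr0n ?mulr0.
by rewrite -ffact_quot// !rmorphM rmorphXn/= ratr_nat -mulr_natl; ring.
Qed.

Lemma f_ofE {R : realType} l m :
  @f_of R l m = fun t => (weight_poly R l m).[hpoly t].
Proof. by apply/funext => t; rewrite /f_of horner_poly big_mkord. Qed.

Lemma is_derive_f_of {R : realType} l m (t : R) :
  is_derive t 1 (f_of l m)
    ((weight_poly R l m)^`().[hpoly t] * (2 * t * (2 * t ^+ 2 - 1))).
Proof.
pose H : {poly R} := 'X^4 - 'X^2 + 1.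
have HE x : H.[x] = hpoly x by rewrite !hornerE.
rewrite f_ofE (_ : (fun t => _) = horner (weight_poly R l m \Po H)); last first.
  by apply/funext => x; rewrite horner_comp HE.
apply: trigger_derive; rewrite deriv_comp hornerM horner_comp HE; congr (_ * _).
rewrite /H !poly.derivE !hornerE/=; ring.
Qed.

(** h(t) - 3/4 = (t^2 - 1/2)^2 and 1 - h(t) = t^2 (1 - t^2). *)
Lemma hpoly_range {R : realType} (t : R) :
  0 <= t <= 1 -> 3 / 4 <= hpoly t <= 1.
Proof.
move=> /andP[t0 t1]; rewrite /hpoly; apply/andP; split.
  have := sqr_ge0 (t ^+ 2 - 1 / 2); lra.
have : 0 <= t ^+ 2 * (1 - t ^+ 2) by rewrite mulr_ge0 ?sqr_ge0// subr_ge0 expr_le1.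
lra.
Qed.

Lemma u_shaped_of_deriv_gt0 {R : realType} l m :
  (forall x : R, 3 / 4 <= x <= 1 -> 0 < (weight_poly R l m)^`().[x]) ->
  forall a : R, 0 < a <= (Num.sqrt 2)^-1 ->
    u_shaped (f_of l m) a 1 (Num.sqrt 2)^-1.
Proof.
move=> G a /andP[a0 a2].
set s : R := (Num.sqrt 2)^-1.
have s0 : 0 < s by rewrite invr_gt0 sqrtr_gt0.
have s2 : s ^+ 2 = 1 / 2 by rewrite exprVn sqr_sqrtr ?mul1r.
have s1 : s <= 1 by rewrite -(@ler_pXn2r _ 2)// ?nnegrE ?ltW// s2; lra.
have dE (t : R) : derive1 (f_of l m) t =
    (weight_poly R l m)^`().[hpoly t] * (2 * t * (2 * t ^+ 2 - 1)).
  by rewrite derive1E; apply: derive_val; exact: is_derive_f_of.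
split => [|t _|t /andP[at_ ts]||t /andP[st t1]].
- by rewrite a2.
- by have [] := is_derive_f_of l m t.
- have t0 : 0 < t := lt_le_trans a0 at_.
  rewrite dE pmulr_rlt0; last first.
    by apply/G/hpoly_range; rewrite !ltW//= (lt_le_trans ts).
  rewrite pmulr_rlt0 ?mulr_gt0//.
  have : t ^+ 2 < s ^+ 2 by rewrite ltr_pXn2r// nnegrE ltW.
  rewrite s2; lra.
- by rewrite dE s2; field.
- have t0 : 0 < t := lt_trans s0 st.
  rewrite dE mulr_gt0//; first by apply/G/hpoly_range; rewrite ltW.
  rewrite mulr_gt0 ?mulr_gt0//.
  have : s ^+ 2 < t ^+ 2 by rewrite ltr_pXn2r// nnegrE ltW.
  rewrite s2; lra.
Qed.

(** * Vectors of norm 1 in an integral lattice *)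

Section DotProduct.
Context {R : realType} {n : nat}.
Implicit Types (x y z : 'rV[R]_n) (L : set 'rV[R]_n).

Lemma dotvE x y : dotv x y = (x *m y^T) ord0 ord0.
Proof. by rewrite mxE; apply: eq_bigr => i _; rewrite mxE. Qed.

Lemma dotvC x y : dotv x y = dotv y x.
Proof. by apply: eq_bigr => i _; rewrite mulrC. Qed.

Lemma dotv0l x : dotv 0 x = 0.
Proof. by rewrite dotvE mul0mx mxE. Qed.

Lemma dotvDl x y z : dotv (x + y) z = dotv x z + dotv y z.
Proof. by rewrite !dotvE mulmxDl mxE. Qed.

Lemma dotvNl x y : dotv (- x) y = - dotv x y.
Proof. by rewrite !dotvE mulNmx mxE. Qed.

Lemma dotv_subsqr x y : dotv (x - y) (x - y) = dotv x x + dotv y y - 2 * dotv x y.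
Proof.
rewrite dotvDl dotvNl !(dotvC _ (x - y)) !dotvDl !dotvNl (dotvC y x); ring.
Qed.

Lemma dotv_row p q (A : 'M[R]_(p, n)) (B : 'M[R]_(q, n)) i j :
  dotv (row i A) (row j B) = (A *m B^T) i j.
Proof. by rewrite mxE; apply: eq_bigr => k _; rewrite !mxE. Qed.

Lemma dotv_ge0 x : 0 <= dotv x x.
Proof. by apply: sumr_ge0 => i _; rewrite -expr2 sqr_ge0. Qed.

Lemma dotv_eq0 x : dotv x x = 0 -> x = 0.
Proof.
move=> /eqP; rewrite psumr_eq0 => [/allP x0|i _]; last by rewrite -expr2 sqr_ge0.
apply/rowP => i; rewrite mxE; apply/eqP.
by have := x0 i (mem_index_enum i); rewrite /= mulf_eq0 orbb.
Qed.

Lemma eq_of_dotv1 x y : dotv x x = 1 -> dotv y y = 1 -> dotv x y = 1 -> x = y.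
Proof.
move=> xx yy xy; apply/eqP; rewrite -subr_eq0; apply/eqP/dotv_eq0.
by rewrite dotv_subsqr xx yy xy; ring.
Qed.

Lemma dotv_unit_le1 x y : dotv x x = 1 -> dotv y y = 1 -> dotv x y <= 1.
Proof.
move=> xx yy; have := dotv_ge0 (x - y). rewrite dotv_subsqr xx yy; lra.
Qed.

(** |x - y|^2 = 2 - 2 <x, y> >= 0 and |x + y|^2 = 2 + 2 <x, y> >= 0 confine the
    integer <x, y> to -1, 0, 1, with equality at the ends only if y = - x or
    y = x. *)
Lemma unit_dotv_int x y : dotv x x = 1 -> dotv y y = 1 ->
  dotv x y \is a Num.int -> [\/ x = y, x = - y | dotv x y = 0].
Proof.
move=> xx yy xyZ.
have nn : dotv (- y) (- y) = 1 by rewrite dotvNl dotvC dotvNl opprK.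
have xny : dotv x (- y) = - dotv x y by rewrite dotvC dotvNl dotvC.
have := dotv_unit_le1 _ _ xx yy; have := dotv_unit_le1 _ _ xx nn; rewrite xny.
move/intrP: xyZ => [c cE]; rewrite cE -mulrNz !lerz1 => c1 c2.
have : c = 0 \/ c = 1 \/ c = -1 by lia.
case=> [c0|[c0|c0]].
- by apply: Or33; rewrite c0.
- by apply: Or31; apply: (eq_of_dotv1 x y xx yy); rewrite cE c0.
- by apply: Or32; apply: (eq_of_dotv1 x (- y) xx nn); rewrite xny cE c0 opprK.
Qed.

(** The coordinates <x, row i Q> of a vector x of L in the orthonormal basis Q
    are inner products of vectors of L, hence integers. *)
Lemma lattice_of_orthonormal L (Q : 'M[R]_n) :
  integral_lattice L -> L = dual_lattice L ->
  Q *m Q^T = 1%:M -> (forall i, L (row i Q)) -> L = lattice_of Q.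
Proof.
move=> LZ Ld QQ QL; apply/seteqP; split=> [x Lx|x [u ->]].
  exists (\row_i Num.floor (dotv x (row i Q))).
  rewrite -[LHS]mulmx1 -(mulmx1C QQ) mulmxA; congr (_ *m _).
  apply/rowP => i; rewrite !mxE floorK; last exact: LZ.
  by apply: eq_bigr => j _; rewrite !mxE.
rewrite Ld => y Ly; rewrite dotvE -mulmxA mxE rpred_sum// => i _.
rewrite mxE rpredM ?intr_int//.
have <- : dotv (row i Q) y = (Q *m y^T) i ord0.
  by rewrite mxE; apply: eq_bigr => j _; rewrite !mxE.
exact: LZ.
Qed.

(** The rows of A form a maximal orthonormal family of L: a vector of norm 1
    which is not among them up to sign is orthogonal to all of them, and would
    enlarge the family. *)
Lemma few_unit_vectors L : integral_lattice L -> L = dual_lattice L ->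
  ~ isometric_to_Zn L ->
  exists k (A : 'M[R]_(k, n)), (k < n)%N /\
    forall x, L x -> dotv x x = 1 -> exists i, x = row i A \/ x = - row i A.
Proof.
move=> LZ Ld nZ.
pose P k := exists A : 'M[R]_(k, n), A *m A^T = 1%:M /\ forall i, L (row i A).
have Pn k : P k -> (k <= n)%N.
  move=> [A [AA _]]; have : (\rank (A *m A^T) <= \rank A)%N := mxrankM_maxl _ _.
  by rewrite AA mxrank1 => /leq_trans; apply; exact: rank_leq_col.
have P0 : exists k, `[< P k >].
  by exists 0%N; apply/asboolP; exists 0; split=> [|[]//]; apply/matrixP => -[].
case: (ex_maxnP P0 (fun k h => Pn k (asboolW h))) => k /asboolP[A [AA AL]] kmax.
exists k, A; split.
  rewrite ltn_neqAle Pn ?andbT; last by exists A.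
  apply/eqP => kn; subst k; apply: nZ; exists A => //.
  exact: lattice_of_orthonormal.
move=> x Lx xx; apply: contrapT => /forallNP xA.
have rowA i : dotv (row i A) (row i A) = 1 by rewrite dotv_row AA mxE eqxx.
have x0 i : dotv x (row i A) = 0.
  have [xi|xi|//] := unit_dotv_int _ _ xx (rowA i) (LZ _ _ Lx (AL i)).
  - by case: (xA i); left.
  - by case: (xA i); right.
suff /asboolT/kmax : P (k + 1)%N by rewrite addn1 ltnn.
exists (col_mx A x); split.
  rewrite tr_col_mx mul_col_row AA.
  have Ax : A *m x^T = 0.
    apply/colP => i; rewrite [RHS]mxE -(x0 i) dotvC.
    by rewrite mxE; apply: eq_bigr => j _; rewrite !mxE.
  have xA0 : x *m A^T = 0 by rewrite -[LHS]trmxK trmx_mul trmxK Ax trmx0.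
  rewrite Ax xA0 scalar_mx_block; congr block_mx.
  by apply/matrixP => i j; rewrite !ord1 -dotvE xx mxE.
move=> i; case: (splitP i) => j ij.
  by rewrite (_ : i = lshift 1 j) ?rowKu//; exact: val_inj.
rewrite (_ : i = rshift k j) ?rowKd; last exact: val_inj.
by rewrite ord1 row_id.
Qed.

End DotProduct.

(** * Bounds for sums over infinite sets *)

Section Sums.
Context {R : realType}.

Lemma set_sum_ge0 {T : choiceType} (D : set T) (f : T -> R) :
  (forall x, 0 <= f x) -> set_sum D f = fine (\esum_(x in D) (f x)%:E).
Proof.
move=> f0; rewrite /set_sum; congr fine.
rewrite [X in (_ - X)%E]esum1 ?sube0 => [|x _]; last first.
  by rewrite funenegE/= max_r// lee_fin oppr_le0.
by apply: eq_esum => x _; rewrite funeposE/= max_l// lee_fin.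
Qed.

Lemma norm_set_sum_le {T : choiceType} (D : set T) (f g : T -> R) :
  (forall x, `|f x| <= g x) -> (\esum_(x in D) (g x)%:E)%E \is a fin_num ->
  `|set_sum D f| <= set_sum D g.
Proof.
move=> fg gfin; have g0 x : 0 <= g x := le_trans (normr_ge0 _) (fg x).
rewrite (set_sum_ge0 _ _ g0) /set_sum.
set G := (\esum_(x in D) (g x)%:E)%E in gfin *.
have pos : (\esum_(x in D) (EFin \o f)^\+%E x <= G)%E.
  apply: le_esum => x _; rewrite funeposE/= ge_max !lee_fin g0 andbT.
  exact: le_trans (ler_norm _) (fg x).
have neg : (\esum_(x in D) (EFin \o f)^\-%E x <= G)%E.
  apply: le_esum => x _; rewrite funenegE/= ge_max !lee_fin g0 andbT.
  by apply: le_trans (fg x); rewrite -normrN ler_norm.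
have pos0 : (0 <= \esum_(x in D) (EFin \o f)^\+%E x)%E.
  by apply: esum_ge0 => x _; exact: funepos_ge0.
have neg0 : (0 <= \esum_(x in D) (EFin \o f)^\-%E x)%E.
  by apply: esum_ge0 => x _; exact: funeneg_ge0.
move: pos neg pos0 neg0.
case: (\esum_(x in D) _)%E => [p| |]; case: (\esum_(x in D) _)%E => [q| |];
  case: G gfin => [G| |]// _; rewrite !lee_fin//= ler_norml => *;
  apply/andP; split; lra.
Qed.

Lemma esum_seq_le {T : choiceType} (s : seq T) (f : T -> \bar R) :
  (forall x, 0 <= f x)%E -> (\esum_(x in [set` s]) f x <= \sum_(x <- s) f x)%E.
Proof.
move=> f0; have -> : [set` s] = [set` undup s].
  by apply/seteqP; split=> x /=; rewrite mem_undup.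
rewrite esum_fset//.
rewrite -fsbig_seq ?undup_uniq//.
elim: s => [|x s IH] //=; case: ifP => _; rewrite !big_cons; last by rewrite leeD2l.
by apply: le_trans IH _; rewrite leeDr.
Qed.

End Sums.

(** * Asymptotic comparison of theta series *)

Section Theta.
Context {R : realType}.

(** The theta series before truncation to a real number: [theta_series] is 0
    when the sum is infinite, so the comparisons are made here. *)
Definition theta_sum {n : nat} (L : set 'rV[R]_n) (tau : R) : \bar R :=
  (\esum_(x in L) (expR (- (pi * tau * dotv x x)))%:E)%E.

Lemma theta_seriesE {n : nat} (L : set 'rV[R]_n) tau :
  theta_series L tau = fine (theta_sum L tau).
Proof. by rewrite /theta_series set_sum_ge0// => x; exact: expR_ge0. Qed.

Lemma theta_sum_ge0 {n : nat} (L : set 'rV[R]_n) tau : (0 <= theta_sum L tau)%E.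
Proof. by apply: esum_ge0 => x _; rewrite lee_fin expR_ge0. Qed.

(** The terms of theta_4 are those of theta_3 up to sign, whence
    |theta_4| <= theta_3.  Should theta_3 be 0, the quotient is 0 by the
    convention on inverses. *)
Lemma t_of_range (tau : R) : 0 <= t_of tau <= 1.
Proof.
rewrite /t_of; set j3 := jacobi3 tau; set j4 := jacobi4 tau.
have j3E : j3 =
    fine (\esum_(v in [set: int]) (expR (- (pi * tau * v%:~R ^+ 2)))%:E)%E.
  by rewrite /j3 /jacobi3 set_sum_ge0// => v; exact: expR_ge0.
have [j30|j3n0] := eqVneq j3 0; first by rewrite j30 expr0n/= invr0 mulr0 lexx ler01.
have j4j3 : `|j4| <= j3.
  apply: norm_set_sum_le => [v|].
    by rewrite normrM normrX normrN1 expr1n mul1r ger0_norm ?expR_ge0.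
  by apply: contraNT j3n0; rewrite j3E; case: (esum _ _).
have j3_gt0 : 0 < j3 by rewrite lt_neqAle eq_sym j3n0 (le_trans _ j4j3).
rewrite divr_ge0 ?sqr_ge0//= ler_pdivrMr ?exprn_gt0// mul1r.
by rewrite -(real_normK (num_real j4)) ler_pXn2r// nnegrE ltW.
Qed.

(** The vectors of L other than 0 and those of norm 1 satisfy |x|^2 >= 2, so
    their terms at tau are at most exp(-2 pi (tau - 1)) times their terms at 1;
    this makes the tail of order exp(-2 pi tau). *)
Lemma theta_sum_le {n : nat} (L : set 'rV[R]_n) (s : seq 'rV[R]_n) (tau : R) :
  integral_lattice L -> 1 <= tau ->
  (forall x, L x -> x != 0 -> dotv x x = 1 -> x \in s) ->
  (forall x, x \in s -> dotv x x = 1) ->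
  (theta_sum L tau <= (1 + expR (- (pi * tau)) *+ size s)%:E
     + (expR (- (2 * pi * (tau - 1)))%R)%:E * theta_sum L 1)%E.
Proof.
move=> LZ tau1 Ls s1; pose e (t : R) (x : 'rV[R]_n) := (expR (- (pi * t * dotv x x)))%:E : \bar R.
have e0 t x : (0 <= e t x)%E by rewrite lee_fin expR_ge0.
rewrite /theta_sum (esumID [set` 0 :: s])//; apply: leeD.
  rewrite esum_mkcondl.
  apply: (@le_trans _ _ (\esum_(x in [set` 0%R :: s]) e tau x)%E).
    by apply: le_esum => x _; case: ifP.
  apply: le_trans (esum_seq_le _ _ (e0 tau)) _.
  rewrite big_cons sumEFin -EFinD lee_fin dotv0l mulr0 oppr0 expR0 lerD2l big_seq.
  rewrite (eq_bigr (fun=> expR (- (pi * tau)))) => [|x /s1 ->]; last by rewrite mulr1.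
  by rewrite -big_seq big_const_seq count_predT iter_addr_0.
apply: ge_ereal_sup => _ [X [finX XL] <-].
set c := expR _; apply: (@le_trans _ _ (\sum_(x \in X) c%:E * e 1%R x)%E).
  apply: lee_fsum => // x /XL[Lx /negP]; rewrite /= inE negb_or => /andP[x0 xs].
  rewrite -EFinM lee_fin /c -expRD ler_expR.
  have : 2 <= dotv x x.
    have := dotv_ge0 x.
    have : dotv x x != 0 by apply: contraNneq x0 => /dotv_eq0 ->.
    have : dotv x x != 1 by apply: contraNneq xs => /(Ls _ Lx x0).
    have /intrP[z ->] := LZ _ _ Lx Lx.
    by rewrite (eqr_int R z 1) (eqr_int R z 0) ler0z (ler_int R 2 z); lia.
  have := pi_ge2 R => p2 d2.
  have : 0 <= pi * (tau - 1) * (dotv x x - 2).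
    by rewrite !mulr_ge0 ?subr_ge0//; lra.
  lra.
rewrite -ge0_mule_fsumr//.
rewrite lee_pmul2l ?lte_fin ?expR_gt0//.
by apply: ereal_sup_ubound; exists X => //; split=> // x /XL[].
Qed.

(** The terms of 0 and of the 2n vectors plus or minus e_i. *)
Lemma theta_sum_Zn_ge n (tau : R) :
  ((1 + expR (- (pi * tau)) *+ (2 * n))%:E
     <= theta_sum (lattice_of (1%:M : 'M[R]_n)) tau)%E.
Proof.
pose d (i : 'I_n) : 'rV[R]_n := delta_mx 0 i.
pose s := 0 :: [seq d i | i <- enum 'I_n] ++ [seq - d i | i <- enum 'I_n].
have dd i : dotv (d i) (d i) = 1.
  rewrite /dotv (bigD1 i)//= big1 => [|j ji]; rewrite !mxE !eqxx ?mulr1 ?addr0//.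
  by rewrite (negbTE ji) mulr0.
have d_inj : injective d.
  move=> i j /rowP/(_ i); rewrite !mxE !eqxx /=; case: eqVneq => // _ /eqP.
  by rewrite oner_eq0.
have dN i j : d i != - d j.
  apply/eqP => /rowP/(_ i); rewrite !mxE !eqxx /= => /eqP.
  by rewrite -addr_eq0 -natrD pnatr_eq0.
have d0 i : d i != 0.
  by apply/eqP => /rowP/(_ i)/eqP; rewrite !mxE !eqxx oner_eq0.
have us : uniq s.
  rewrite cons_uniq mem_cat negb_or cat_uniq -andbA.
  rewrite !map_inj_uniq//; last by move=> i j /oppr_inj/d_inj.
  rewrite -enumT !enum_uniq andbT /=; apply/and3P; split.
  - by apply/mapP => -[i _] /esym/eqP; rewrite (negbTE (d0 i)).
  - by apply/mapP => -[i _] /esym/eqP; rewrite oppr_eq0 (negbTE (d0 i)).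
  - apply/hasPn => _ /mapP[i _ ->]; apply/mapP => -[j _] /esym/eqP.
    by rewrite (negbTE (dN _ _)).
apply: esum_ge; exists [set` s].
  split=> [|x]; first exact: finite_seq.
  have Zd i : map_mx intr (delta_mx 0 i : 'rV[int]_n) = d i.
    exact: map_delta_mx.
  rewrite /= inE mem_cat => /orP[/eqP ->|/orP[/mapP[i _ ->]|/mapP[i _ ->]]].
  - by exists 0; rewrite map_mx0 mul0mx.
  - by exists (delta_mx 0 i); rewrite Zd mulmx1.
  - by exists (- delta_mx 0 i); rewrite map_mxN Zd mulmx1.
rewrite -fsbig_seq// sumEFin lee_fin big_cons big_cat !big_map /=.
rewrite dotv0l mulr0 oppr0 expR0 lerD2l.
under eq_bigr do rewrite dd mulr1.
under [X in _ + X]eq_bigr do rewrite dotvNl dotvC dotvNl opprK dd mulr1.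
by rewrite -enumT !big_enum sumr_const card_ord -mulrnDr mul2n -addnn.
Qed.

(** If the ratio were at least 1 for all tau, the two expansions would give
    2n q <= 2k q + C q^2 with k < n and q = exp(-pi tau), which fails as soon as
    C q < 1. *)
Lemma theta_ratio_lt1 {n : nat} (L : set 'rV[R]_n) :
  unimodular L -> ~ isometric_to_Zn L ->
  exists2 tau : R, 0 < tau & theta_ratio L tau < 1.
Proof.
move=> [_ LZ Ld] nZ; apply: contrapT => noTau.
(* A ratio of at least 1 also forces both sums to be finite: an infinite sum
   is truncated to 0, and so is the quotient. *)
have ratio tau : 0 < tau ->
    [/\ theta_sum L tau \is a fin_num &
        (theta_sum (lattice_of (1%:M : 'M[R]_n)) tau <= theta_sum L tau)%E].
  move=> tau0; have {noTau} : 1 <= theta_ratio L tau.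
    by rewrite leNgt; apply/negP => lt1; apply: noTau; exists tau.
  rewrite /theta_ratio !theta_seriesE.
  have := theta_sum_ge0 L tau.
  have := theta_sum_ge0 (lattice_of (1%:M : 'M[R]_n)) tau.
  case: (theta_sum (lattice_of _) tau) => [z| |]//=;
    case: (theta_sum L tau) => [y| |]//=;
    rewrite ?invr0 ?mulr0 ?mul0r ?ler10// !lee_fin => z0 y0.
  have [->|zn0] := eqVneq z 0; first by rewrite invr0 mulr0 ler10.
  by rewrite ler_pdivlMr ?mul1r// lt_neqAle eq_sym zn0.
have [k [A [kn LA]]] := few_unit_vectors L LZ Ld nZ.
pose s := [seq x <- [seq row i A | i <- enum 'I_k]
                    ++ [seq - row i A | i <- enum 'I_k] | dotv x x == 1].
have size_s : (size s <= 2 * k)%N.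
  rewrite size_filter (leq_trans (count_size _ _))// size_cat !size_map.
  by rewrite -enumT size_enum_ord mul2n addnn.
have [/fineK T1E _] := ratio 1 ltr01; set T1 := fine _ in T1E.
have T1_ge0 : 0 <= T1 by rewrite fine_ge0// theta_sum_ge0.
pose C := expR (2 * pi) * T1 : R.
have C0 : 0 <= C by rewrite mulr_ge0 ?expR_ge0.
(* This tau is large enough for q * C < 1, as exp(pi tau) >= 1 + tau > C. *)
pose tau := 1 + C.
have tau1 : 1 <= tau by rewrite lerDl.
pose q := expR (- (pi * tau)) : R.
have q0 : 0 < q by exact: expR_gt0.
have qC : q * C < 1.
  rewrite /q expRN mulrC ltr_pdivrMr ?expR_gt0// mul1r.
  apply: lt_le_trans (expR_ge1Dx _).
  have : 0 <= (pi - 2) * tau by rewrite mulr_ge0 ?subr_ge0 ?pi_ge2//; lra.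
  rewrite /tau; lra.
have [_ ZL] := ratio tau (lt_le_trans ltr01 tau1).
have := le_trans (theta_sum_Zn_ge n tau)
  (le_trans ZL (theta_sum_le L s tau LZ tau1 _ _)).
rewrite -T1E -EFinM -EFinD lee_fin -/q.
have -> : expR (- (2 * pi * (tau - 1))) * T1 = q ^+ 2 * C.
  by rewrite /C mulrA; congr (_ * _); rewrite /q -expRM_natl -expRD; congr expR; ring.
move=> H; have {H} : 1 + q *+ (2 * n) <= 1 + q *+ size s + q ^+ 2 * C.
  apply: H => [x Lx _ xx|x]; last by rewrite mem_filter => /andP[/eqP].
  rewrite mem_filter xx eqxx mem_cat; have [i [->|->]] := LA x Lx xx.
    by rewrite (map_f (fun i => row i A)) ?mem_enum.
  by rewrite orbC (map_f (fun i => - row i A)) ?mem_enum.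
have : q *+ (size s).+1 <= q *+ (2 * n).
  by apply: ler_wpMn2l; [exact: ltW|lia].
have : q * (q * C) < q * 1 by rewrite ltr_pM2l.
rewrite mulrS; lra.
Qed.

End Theta.

(** * The theorem *)

(** Here the theta ratio is 1 - m_1 (1 - h(t)) with h(t) <= 1, and it is below 1
    for some tau. *)
Lemma linear_weight_gt0 {R : realType} {n : nat} (L : set 'rV[R]_n) (m : nat -> rat) :
  unimodular L -> ~ isometric_to_Zn L -> m 0%N + m 1%N = 1 ->
  (forall tau : R, 0 < tau ->
     theta_ratio L tau = ratr (m 0%N) + ratr (m 1%N) * hpoly (t_of tau)) ->
  0 < m 1%N.
Proof.
move=> Lu nZ m01 hm; have [tau tau0] := theta_ratio_lt1 L Lu nZ.
have /andP[_ h1] := hpoly_range _ (t_of_range tau).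
rewrite hm//; have -> : m 0%N = 1 - m 1%N by rewrite -m01 addrK.
rewrite rmorphB rmorph1; case: (ltP 0 (m 1%N)) => // m1_le0.
have : 0 <= ratr (m 1%N) * (hpoly (t_of tau) - 1) :> R.
  by apply: mulr_le0; rewrite ?ler_wpDl ?subr_le0// lerq0.
lra.
Qed.

Theorem theorem3 (R : realType) (n : nat) (L : set 'rV[R]_n) (m : nat -> rat)
  (hn : (8 <= n)%N)
  (hL : unimodular L)
  (hZ : (n < 16)%N -> ~ isometric_to_Zn L)
  (hm1 : \sum_(0 <= r < (n %/ 8).+1) m r = 1)
  (hm : forall tau : R, 0 < tau ->
     theta_ratio L tau =
       \sum_(0 <= r < (n %/ 8).+1) ratr (m r) * hpoly (t_of tau) ^+ r)
  (hpos : forall j : nat, (1 <= j <= n %/ 8 - 1)%N ->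
     0 < Num.min (mu (n %/ 8) m j) (nu (n %/ 8) m j)) :
  forall a : R, 0 < a <= (Num.sqrt 2)^-1 ->
    u_shaped (f_of (n %/ 8) m) a 1 (Num.sqrt 2)^-1.
Proof.
apply: u_shaped_of_deriv_gt0; set l := (n %/ 8)%N in hm1 hm hpos *.
have l_gt0 : (0 < l)%N by rewrite divn_gt0.
have muE j : (weight_poly R l m)^`(j).[3 / 4] = ratr (mu l m j).
  by rewrite /mu -horner_weight_derivn fmorph_div/= !ratr_nat.
have nuE j : (weight_poly R l m)^`(j).[1] = ratr (nu l m j).
  rewrite -(rmorph1 (@ratr R)) horner_weight_derivn; congr ratr.
  by apply: eq_bigr => r _; rewrite expr1n mulr1.
have [l_le1|l_gt1] := leqP l 1.
  have n16 : (n < 16)%N by move: l_le1; rewrite /l; lia.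
  have l1 : l = 1%N by apply/eqP; rewrite eqn_leq l_le1.
  have m1 : 0 < m 1%N.
    apply: (linear_weight_gt0 L m hL (hZ n16)) => [|tau tau0].
      by rewrite -hm1 l1 !big_nat_recr//= big_geq// add0r.
    by rewrite hm// l1 !big_nat_recr//= big_geq// add0r expr0 mulr1 expr1.
  have c0 : forall x : R, (weight_poly R l m)^`().[x] = ratr (m 1%N).
    move=> x; rewrite (@horner_coef_wide _ 1).
      by rewrite big_ord1 coef_deriv coef_poly l1 expr0 mulr1.
    have [->|p0] := eqVneq (weight_poly R l m) 0.
      by rewrite deriv0 size_poly0.
    by rewrite -ltnS (leq_trans (lt_size_deriv p0))// l1 size_poly.
  by move=> x _; rewrite c0 ltr0q.
have pos j : (j <= l - 2)%N ->
    0 < (weight_poly R l m)^`()^`(j).[3 / 4] /\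
    0 < (weight_poly R l m)^`()^`(j).[1].
  move=> jl.
  have -> : (weight_poly R l m)^`()^`(j) = (weight_poly R l m)^`(j.+1).
    by rewrite /derivn iterSr.
  rewrite muE nuE !ltr0q; apply/andP; rewrite -lt_min; apply: hpos; lia.
apply: (horner_gt0_of_derivs (3 / 4) 1 (l - 2)).
- have -> : (l - 2).+2 = l by lia.
  have [->|p0] := eqVneq (weight_poly R l m) 0.
    by rewrite deriv0 size_poly0.
  by rewrite -ltnS (leq_trans (lt_size_deriv p0))// size_poly.
- by move=> j /pos[].
- by have [] := pos _ (leqnn _).
Qed.
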